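(* For every squarefree integer $n\geq 2$, \[ a(n)=\sum_{\substack{d\mid n\\ d\neq 1}}(-1)^{\omega(d)+1}\frac{d}{d-\varphi(d)}, \] where $\omega(d)$ is the number of distinct prime divisors of $d$ and $\varphi$ is Euler's totient function.
   Context: For a positive integer $n$, consider the random walk on $\mathbb{Z}/n\mathbb{Z}$ that starts at the residue $1 \pmod n$ and at each step multiplies the current state by a residue chosen uniformly at random from $\mathbb{Z}/n\mathbb{Z}$, independently of previous choices. The state $0\pmod n$ is absorbing. $a(n)$ denotes the expected number of steps until the walk first reaches $0 \pmod n$. *)

(* Defs.v *)
From HB Require Import structures.
From mathcomp Require Import all_boot all_order all_algebra.
From mathcomp Require Import all_classical all_reals all_analysis.

Set Implicit Arguments.
Unset Strict Implicit.
Unset Printing Implicit Defensive.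

Import Order.TTheory GRing.Theory Num.Theory.

Local Open Scope classical_set_scope.
Local Open Scope ring_scope.
Local Open Scope ereal_scope.

Definition squarefree (n : nat) : Prop :=
  forall p : nat, prime p -> ~~ (p ^ 2 %| n)%N.

Definition omega (d : nat) : nat := size (primes d).

(* Mutual independence of random variables with values in a discrete space:
   every set of values is measurable. *)
Definition independent_rvs (d : measure_display) (Om : measurableType d)
    (R : realType) (P : probability Om R) (S : Type) (X : nat -> Om -> S) :
    Prop :=
  forall (J : seq nat) (B : nat -> set S), uniq J ->
    P (\big[setI/setT]_(j <- J) (X j @^-1` B j)) =
    \prod_(j <- J) P (X j @^-1` B j).

(* 'Z_n is Z/nZ only for n >= 2. *)
Record iid_uniform_residues (d : measure_display) (Om : measurableType d)
    (R : realType) (P : probability Om R) (n : nat) (U : nat -> Om -> 'Z_n) :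
    Prop := IidUniformResidues {
  iid_measurable : forall (k : nat) (B : set 'Z_n), measurable (U k @^-1` B) ;
  iid_uniform : forall (k : nat) (a : 'Z_n),
    P (U k @^-1` [set a]) = (n%:R^-1 : R)%:E ;
  iid_independent : independent_rvs P U }.

Fixpoint walk (Om : Type) (n : nat) (U : nat -> Om -> 'Z_n) (k : nat)
    (w : Om) : 'Z_n :=
  if k is k'.+1 then (walk U k' w * U k' w)%R else 1%R.

(* The infimum is +oo when the walk never reaches 0. *)
Definition hitting_time (R : realType) (Om : Type) (n : nat)
    (U : nat -> Om -> 'Z_n) (w : Om) : \bar R :=
  ereal_inf [set (k%:R : R)%:E | k in [set k : nat | walk U k w = 0%R]].

Definition expected_hitting_time (d : measure_display) (Om : measurableType d)
    (R : realType) (P : probability Om R) (n : nat) (U : nat -> Om -> 'Z_n) :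
    \bar R :=
  \int[P]_w hitting_time R U w.

(* Main.v *)
(* The hitting time is the number of [k] with [walk U k w != 0], since 0 is
   absorbing, so its expectation is the sum over [k] of P(walk_k != 0).  For
   squarefree [n], inclusion-exclusion over the primes dividing [n] writes the
   indicator of [x != 0 mod n] as the alternating sum over the divisors
   [d != 1] of the indicators of [coprime x d].  A product is coprime to [d]
   iff all its factors are, so P(walk_k coprime to d) = (totient d / d) ^ k by
   independence, and summing the geometric series over [k] gives the formula. *)
Require Import Defs.
From mathcomp Require Import all_boot all_order all_algebra.
From mathcomp Require Import all_classical all_reals all_analysis.

Import Order.TTheory GRing.Theory Num.Theory numFieldNormedType.Exports.
Local Open Scope ring_scope.

(** * Alternating sums over the divisors of a squarefree number *)

(** If [p] divides [d], cancel it from both sides; otherwise [d] is coprime to [p] and Gauss's lemma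
    gives [d %| m]. *)
Lemma mem_divisors_pM (p m d : nat) : prime p -> (0 < m)%N ->
  (d \in divisors (p * m)) =
  (d \in divisors m) || (d \in [seq (p * e)%N | e <- divisors m]).
Proof.
move=> pp m0; have p0 := prime_gt0 pp.
rewrite -!dvdn_divisors ?muln_gt0 ?p0//; apply/idP/orP => [dpm|[dm|]].
- have [/dvdnP[e dE]|pd] := boolP (p %| d)%N.
    right; move: dpm; rewrite dE mulnC dvdn_pmul2l// => em.
    by rewrite map_f// -dvdn_divisors.
  by left; rewrite -(@Gauss_dvdr d p m) // coprime_sym prime_coprime.
- exact: dvdn_mull.
- by case/mapP => e; rewrite -dvdn_divisors// => em ->; rewrite dvdn_pmul2l.
Qed.

(** Since [p] does not divide [m], the divisors of [m] and their multiples by [p] are disjoint, so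
    each divisor of [p * m] is counted once. *)
Lemma sum_divisors_pM (V : nmodType) (p m : nat) (F : nat -> V) :
  prime p -> ~~ (p %| m)%N -> (0 < m)%N ->
  \sum_(d <- divisors (p * m)) F d =
  \sum_(d <- divisors m) (F d + F (p * d)%N).
Proof.
move=> pp pm m0; rewrite big_split /=.
rewrite -(big_map (muln p) xpredT F) -big_cat.
apply: perm_big; apply: uniq_perm; first exact: divisors_uniq.
  rewrite cat_uniq divisors_uniq map_inj_uniq ?divisors_uniq ?andbT /=.
    apply/hasPn => _ /mapP[e _ ->]; apply: contra pm.
    by rewrite -dvdn_divisors// => /(dvdn_trans (dvdn_mulr _ (dvdnn _))).
  by move=> x y /eqP; rewrite eqn_pmul2l ?prime_gt0// => /eqP.
by move=> d; rewrite mem_cat mem_divisors_pM.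
Qed.

Lemma omega_pM (p d : nat) : prime p -> ~~ (p %| d)%N -> (0 < d)%N ->
  omega (p * d) = (omega d).+1.
Proof.
move=> pp pd d0; rewrite /omega -/(size (p :: primes d)).
apply: perm_size; apply: uniq_perm; first exact: primes_uniq.
  by rewrite /= primes_uniq mem_primes pp d0 (negbTE pd).
by move=> q; rewrite primesM ?(prime_gt0 pp) ?d0// (primes_prime pp) !inE.
Qed.

(* A prime [p] dividing [n] but not [x] pairs the divisors [d] and [p * d],
   whose terms cancel; if there is none, only [d = 1] contributes. *)
Lemma sum_divisors_coprime (A : pzRingType) (n x : nat) :
  (0 < n)%N -> squarefree n ->
  \sum_(d <- divisors n) (-1) ^+ omega d * (coprime x d)%:R =
  (n %| x)%:R :> A.
Proof.
move=> n0 sqn; have [nx|nx] := boolP (n %| x)%N.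
  rewrite (bigD1_seq 1%N) ?divisors_uniq//=; last by rewrite -dvdn_divisors.
  rewrite coprimen1 mulr1 expr0 big_seq_cond big1 ?addr0// => d /andP[].
  rewrite -dvdn_divisors// => dn; rewrite /coprime => /negPf d1.
  by rewrite (gcdn_idPr (dvdn_trans dn nx)) d1 mulr0.
(* As [n] is squarefree, its [p]-part is [p] itself for each prime [p] dividing it; if all these
   primes divided [x], so would [n]. *)
have [p pn px] : exists2 p, p \in primes n & ~~ (p %| x)%N.
  apply/hasP; apply: contraR nx => /hasPn px.
  have [->|x0] := posnP x; first exact: dvdn0.
  apply/dvdn_partP => // p pn; rewrite p_part.
  have := pn; rewrite mem_primes => /and3P[pp _ dpn].
  suff -> : logn p n = 1%N by have := px p pn; rewrite negbK.
  apply/eqP; rewrite eqn_leq -pfactor_dvdn// expn1 dpn andbT.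
  by rewrite leqNgt -pfactor_dvdn// sqn.
move: pn; rewrite mem_primes => /and3P[pp _ /dvdnP[m nE]].
have m0 : (0 < m)%N by move: n0; rewrite nE muln_gt0 => /andP[].
have pm : ~~ (p %| m)%N.
  apply: contra (sqn p pp) => /dvdnP[k mE].
  by rewrite nE mE -mulnA mulnn dvdn_mull.
rewrite nE mulnC sum_divisors_pM// big_seq big1// => d.
rewrite -dvdn_divisors// => dm.
rewrite omega_pM ?(dvdn_gt0 m0)//; last first.
  by apply: contra pm => /dvdn_trans; apply.
(* Because [p] does not divide [x], the numbers [d] and [p * d] pass the same coprimality test,
   while their signs are opposite. *)
rewrite coprimeMr (coprime_sym x p) (prime_coprime x pp) px /=.
by rewrite exprS mulN1r mulNr subrr.
Qed.

(** * Counting integers coprime to [d] *)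

(** Coprimality to [d] is periodic of period [d], so each of the [m] blocks of length [d]
    contributes [totient d]. *)
Lemma sum_coprime_multiple (d m : nat) :
  (\sum_(0 <= i < m * d) coprime i d = m * totient d)%N.
Proof.
rewrite big_nat_mul.
under eq_bigr => i _.
  rewrite mulSn addnC -{1}[(i * d)%N]add0n big_addn addKn.
  under eq_bigr => j _
    do rewrite addnC coprime_sym /coprime gcdnMDl -/(coprime _ _).
  rewrite -totient_count_coprime.
  over.
by rewrite big_const_nat subn0 iter_addn_0 mulnC.
Qed.

Lemma totient_lt (d : nat) : (1 < d)%N -> (totient d < d)%N.
Proof.
case: d => [//|d d1]; rewrite totient_count_coprime big_ltn//.
(* The residue 0 is not coprime to [d > 1], which leaves at most [d - 1] residues. *)
rewrite {1}/coprime gcdn0 (gtn_eqF d1) add0n ltnS.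
rewrite (leq_trans (leq_sum _ (fun i _ => leq_b1 _)))//.
by rewrite sum_nat_const_nat subn1 muln1.
Qed.

(** * Finite-valued variables and the hitting time *)

(** The event is a finite disjoint union of fibres of [X]. Taking [fine] of the point masses keeps
    later computations in [R]. *)
Lemma probability_preimage_sum (R : realType) (disp : measure_display)
    (Om : measurableType disp) (P : probability Om R) (T : finType)
    (X : Om -> T) (A : pred T) :
  (forall a, measurable (X @^-1` [set a])%classic) ->
  P (X @^-1` [set a | A a])%classic =
  (\sum_(a | A a) fine (P (X @^-1` [set a])%classic))%:E.
Proof.
move=> mX.
transitivity (P (\bigcup_(a in [set` enum A]) X @^-1` [set a])%classic).
  congr (P _); apply/seteqP; split => [w /= Aw|w [a /= + ->]].
    by exists (X w) => //=; rewrite mem_enum.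
  by rewrite mem_enum.
rewrite measure_fin_bigcup//; last exact: trivIset_preimage1.
rewrite -fsbig_seq ?enum_uniq// big_enum_cond /=.
rewrite EFin_sum_fine; last by move=> a _; exact: fin_num_measure.
by apply: eq_bigl => a; rewrite andbT.
Qed.

Lemma hitting_time_series (R : realType) (Om : Type) (n : nat)
    (U : nat -> Om -> 'Z_n) (w : Om) :
  hitting_time R U w =
  (\sum_(0 <= k <oo) ((walk U k w != 0)%R%:R : R)%:E)%E.
Proof.
have absorb k j : walk U k w = 0 -> walk U (k + j) w = 0.
  by move=> w0; elim: j => [|j IH]; rewrite ?addn0// addnS /= IH mul0r.
have u_ge0 k : (0 <= k)%N -> xpredT k -> (0 <= ((walk U k w != 0)%:R : R)%:E)%E.
  by rewrite lee_fin.
rewrite /hitting_time.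
have [[k0 wk0]|nohit] := pselect (exists k, walk U k w = 0).
  have ex : exists k, walk U k w == 0 by exists k0; apply/eqP.
  have [m /eqP wm mmin] := ex_minnP ex.
  (* With [m] the first hit, the terms before [m] are 1 and those from [m] on vanish. *)
  rewrite (nneseries_split 0 m)// add0n eseries0 ?adde0; last first.
    by move=> k mk _; rewrite -(subnKC mk) absorb// eqxx.
  rewrite big_nat (eq_bigr (fun=> (1 : R)%:E)); last first.
    move=> k /andP[_ km]; case: eqP => // wk.
    by have := mmin k; rewrite wk eqxx leqNgt km => /(_ isT).
  rewrite -big_nat sumEFin big_const_nat subn0 iter_addr_0.
  apply/eqP; rewrite eq_le; apply/andP; split.
    by apply: ereal_inf_lbound; exists m.
  apply: le_ereal_inf_tmp => _ [k /= wk <-].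
  by rewrite lee_fin ler_nat mmin// wk.
rewrite [X in ereal_inf X](_ : _ = set0); last first.
  by rewrite -subset0 => _ [k /= wk _]; apply: nohit; exists k.
rewrite ereal_inf0; apply/esym/eqyP => r r0.
(* The walk never hits 0, so the first [Num.bound r] terms are all 1 and already sum to at least
   [r]. *)
apply: le_trans (nneseries_lim_ge (Num.bound r) u_ge0).
rewrite (eq_bigr (fun=> (1 : R)%:E)); last first.
  by move=> k _; case: eqP => // wk; case: nohit; exists k.
rewrite sumEFin lee_fin big_const_nat subn0 iter_addr_0.
by rewrite ltW// archi_boundP// ltW.
Qed.

(** * The law of the walk *)

Section walk_law.
Context {R : realType} {disp : measure_display} {Om : measurableType disp}.
Context {P : probability Om R} {n : nat} {U : nat -> Om -> 'Z_n}.
Hypotheses (n_ge2 : (2 <= n)%N) (U_iid : iid_uniform_residues P U).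

(** Splitting by the value of the walk at time [k] gives a finite union of measurable events. *)
Lemma measurable_walk k (B : set 'Z_n) : measurable (walk U k @^-1` B)%classic.
Proof.
elim: k B => [|k IH] B /=; first by rewrite preimage_cst; case: ifP.
rewrite (_ : _ @^-1` B = \bigcup_(a in [set: 'Z_n])
    (walk U k @^-1` [set a] `&` U k @^-1` [set b | B (a * b)%R]))%classic.
  apply: fin_bigcup_measurable => // a _.
  by apply: measurableI; [exact: IH|exact: (iid_measurable U_iid)].
apply/seteqP; split=> [w /= Bw|w [a _ [/= <-]]//].
by exists (walk U k w).
Qed.

(** Reduction modulo [n] preserves coprimality to [d] because [d] divides [n]. *)
Lemma coprime_Zp_mul (d : nat) (x y : 'Z_n) : (d %| n)%N ->
  coprime (x * y)%R d = coprime x d && coprime y d.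
Proof.
move=> dn; rewrite /= -coprimeMl -coprime_modl modn_dvdm ?coprime_modl//.
by rewrite Zp_cast.
Qed.

Lemma coprime_walk (d k : nat) (w : Om) : (d %| n)%N ->
  coprime (walk U k w) d = all (fun i => coprime (U i w) d) (iota 0 k).
Proof.
move=> dn; elim: k => [|k IH]; first by rewrite /= coprime1n.
rewrite [walk _ _ _]/= coprime_Zp_mul// IH.
by rewrite -[in iota _ _.+1]addn1 iotaD all_cat /= andbT.
Qed.

Lemma sum_Zp_coprime (d : nat) : (d %| n)%N ->
  (\sum_(a : 'Z_n) coprime a d = n %/ d * totient d)%N.
Proof.
move=> dn; rewrite -sum_coprime_multiple divnK//.
by rewrite -[in RHS](Zp_cast n_ge2) big_mkord.
Qed.

(** Dividing the number [n %/ d * totient d] of favourable residues by [n] cancels the factor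
    [n %/ d]. *)
Lemma probability_step_coprime (d k : nat) : (d %| n)%N ->
  P (U k @^-1` [set a | coprime a d])%classic =
  ((totient d)%:R / d%:R : R)%:E.
Proof.
move=> dn; rewrite (@probability_preimage_sum _ _ _ _ _ _
  (fun a : 'Z_n => coprime a d)); last first.
  by move=> a; exact: (iid_measurable U_iid).
under eq_bigr do rewrite (iid_uniform U_iid) /=.
rewrite big_mkcond /=; congr EFin.
under eq_bigr do rewrite -mulrb -(mulr_natr n%:R^-1).
rewrite -mulr_sumr -natr_sum sum_Zp_coprime//.
have n0 : (0 < n)%N := ltnW n_ge2.
have d0 : (0 < d)%N := dvdn_gt0 n0 dn.
have m0 : (0 < n %/ d)%N by rewrite divn_gt0// dvdn_leq.
rewrite -[in n%:R](divnK dn) !natrM invfM mulrACA mulVf ?mul1r 1?mulrC//.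
by rewrite pnatr_eq0 -lt0n.
Qed.

Lemma probability_walk_coprime (d k : nat) : (d %| n)%N ->
  P (walk U k @^-1` [set a | coprime a d])%classic =
  (((totient d)%:R / d%:R) ^+ k : R)%:E.
Proof.
move=> dn.
transitivity (P (\big[setI/setT]_(i <- iota 0 k)
    (U i @^-1` [set a | coprime a d]))%classic).
  congr (P _); apply/funext => w; rewrite /= coprime_walk// -bigcap_seq.
  apply/propext; split=> [/allP h i /= ik|h]; first exact: h.
  by apply/allP => i ik; exact: h.
rewrite (iid_independent U_iid (fun=> [set a | coprime a d]%classic)
  (iota_uniq 0 k)).
under eq_bigr do rewrite probability_step_coprime//.
by rewrite prodEFin big_const_seq count_predT size_iota iter_mulr mulr1.
Qed.

Lemma probability_walk_neq0 (k : nat) : squarefree n ->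
  P (walk U k @^-1` [set a | a != 0%R])%classic =
  (\sum_(d <- divisors n | d != 1%N)
     (-1) ^+ (omega d + 1) * ((totient d)%:R / d%:R) ^+ k : R)%:E.
Proof.
move=> sqn; have n0 : (0 < n)%N := ltnW n_ge2.
have mW a : measurable (walk U k @^-1` [set a])%classic.
  exact: measurable_walk.
rewrite (@probability_preimage_sum _ _ _ _ _ _ (fun a : 'Z_n => a != 0%R))//.
pose q (a : 'Z_n) : R := fine (P (walk U k @^-1` [set a])%classic).
congr EFin; rewrite big_mkcond /=.
transitivity (\sum_(a : 'Z_n) \sum_(d <- divisors n | d != 1%N)
    (-1) ^+ (omega d + 1) * (q a * (coprime a d)%:R)).
  apply: eq_bigr => a _.
  (* The term [d = 1] equals 1, so the other terms sum to [(n %| a) - 1]; the extra 1 in the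
     exponent of the sign turns this into the indicator of [a != 0]. *)
  have := @sum_divisors_coprime R n a n0 sqn.
  rewrite (bigD1_seq 1%N) ?divisors_uniq//=; last by rewrite -dvdn_divisors.
  rewrite coprimen1 mulr1 expr0 => /(canRL (addKr _)) sE.
  under eq_bigr do rewrite addn1 exprS mulN1r mulNr mulrCA.
  rewrite sumrN -mulr_sumr sE.
  (* The representative of [a] lies below [n], so [n] divides it only when it is 0. *)
  have -> : (n %| a)%N = (a == 0%R).
    apply/idP/eqP => [na|->]; last exact: dvdn0.
    apply/val_inj => /=; apply/eqP; rewrite -leqn0 leqNgt; apply/negP => a0.
    have := dvdn_leq a0 na.
    by rewrite leqNgt -[X in (_ < X)%N](Zp_cast n_ge2) ltn_ord.
  case: (a == 0%R); rewrite /= ?addNr ?mulr0 ?oppr0//.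
  by rewrite addr0 mulrN mulr1 opprK.
rewrite exchange_big /= big_seq_cond [RHS]big_seq_cond.
apply: eq_bigr => d /andP[]; rewrite -dvdn_divisors// => dn _.
rewrite -mulr_sumr; congr (_ * _).
have := probability_walk_coprime d k dn.
rewrite (@probability_preimage_sum _ _ _ _ _ _
  (fun a : 'Z_n => coprime a d))// => -[<-].
rewrite [RHS]big_mkcond; apply: eq_bigr => a _.
by case: coprime; rewrite ?mulr1 ?mulr0.
Qed.

End walk_law.

Theorem theorem3p1 (R : realType) (disp : measure_display)
    (Om : measurableType disp) (P : probability Om R) (n : nat)
    (U : nat -> Om -> 'Z_n) (n_ge2 : (2 <= n)%N) (n_sqfree : squarefree n)
    (U_iid : iid_uniform_residues P U) :
  expected_hitting_time P U =
  (\sum_(d <- divisors n | d != 1%N)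
     (-1) ^+ (omega d + 1) * (d%:R / (d%:R - (totient d)%:R)) : R)%:E.
Proof.
rewrite /expected_hitting_time.
under eq_integral do rewrite hitting_time_series.
have mW k : measurable (walk U k @^-1` [set a | a != 0%R])%classic.
  exact: (measurable_walk U_iid).
have indicE k : (fun w => ((walk U k w != 0)%:R : R)%:E) =
    (fun w => (\1_(walk U k @^-1` [set a | a != 0%R])%classic w)%:E).
  apply/funext => w; rewrite indicE; congr ((nat_of_bool _)%:R)%:E.
  by apply/idP/idP; rewrite inE.
(* The terms are nonnegative, so expectation and infinite sum may be exchanged before finiteness is
   known. *)
rewrite integral_nneseries//; last first.
  move=> k; rewrite indicE; apply/measurable_realfun.measurable_EFinP.
  exact: measurable_realfun.measurable_indic.
have n0 : (0 < n)%N := ltnW n_ge2.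
pose s k : R := \sum_(d <- divisors n | d != 1%N)
  (-1) ^+ (omega d + 1) * ((totient d)%:R / d%:R) ^+ k.
rewrite (@eq_eseriesr _ _ (fun k => (s k)%:E)); last first.
  move=> k _; rewrite indicE integral_indic// setIT.
  exact: (probability_walk_neq0 n_ge2 U_iid).
set L := (X in _ = X%:E).
have : (series s @ \oo --> L)%classic.
  (* The partial sums are finite combinations of geometric partial sums, so the limit can be taken
     divisor by divisor. *)
  rewrite (_ : series s = fun N => \sum_(d <- divisors n | d != 1%N)
      series (geometric ((-1) ^+ (omega d + 1)) ((totient d)%:R / d%:R)) N);
    last first.
    by apply/funext => N; rewrite /series/= exchange_big.
  rewrite /L big_seq_cond.
  under eq_cvg do rewrite big_seq_cond.
  apply: (cvg_big (op := +%R)) => [|d /andP[]]; first exact: add_continuous.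
  rewrite -dvdn_divisors// => dn d1.
  have d_gt0 : (0 < d)%N := dvdn_gt0 n0 dn.
  (* Excluding [d = 1] makes every ratio [totient d / d] less than 1. *)
  have td : (totient d < d)%N by rewrite totient_lt// ltn_neqAle eq_sym d1.
  have dR : d%:R != 0 :> R by rewrite pnatr_eq0 -lt0n.
  rewrite (_ : d%:R / _ = (1 - (totient d)%:R / d%:R)^-1).
    apply: cvg_geometric_series.
    by rewrite ger0_norm ?divr_ge0// ltr_pdivrMr ?ltr0n// mul1r ltr_nat.
  by rewrite -[LHS]invf_div mulrBl divff.
move=> sL; have <- : limn (series s) = L by exact: cvg_lim.
rewrite -EFin_lim; last exact: cvgP sL.
by congr (limn _); apply/funext => N /=; rewrite sumEFin.
Qed.
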